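(* Let $m_1,m_2\geq 1$, $m=m_1+m_2$, $j=\mathrm{diag}(I_{m_1},-I_{m_2})$, and let $\{C_k\}_{k\geq 0}$ be a sequence of $m\times m$ matrices with $C_k>0$ and $C_kjC_k=j$ for all $k\geq 0$. Then the discrete Dirac system $y_{k+1}(z)=(I_m+\mathrm{i} z jC_k)y_k(z)$ $(k\geq 0)$ has a unique Weyl function $\varphi$, and this Weyl function is analytic and contractive (i.e. $\varphi(z)^*\varphi(z)\leq I_{m_2}$) on the open lower half-plane $\mathbb{C}_-$.
   Context: The fundamental solution $\{W_k(z)\}$ of the system is defined by $W_0(z)=I_m$, $W_{k+1}(z)=(I_m+\mathrm{i} z jC_k)W_k(z)$. Put $q(z)=(1+|z|^2)^{-1}$. A Weyl function of the system is an $m_1\times m_2$ matrix function $\varphi$ on $\mathbb{C}_-$ such that for every $z\in\mathbb{C}_-$ the series $\sum_{k=0}^\infty q(z)^k\begin{bmatrix}\varphi(z)^* & I_{m_2}\end{bmatrix}W_k(z)^*C_kW_k(z)\begin{bmatrix}\varphi(z)\\ I_{m_2}\end{bmatrix}$ is finite (converges). *)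

(* Defs.v *)
(* Complex numbers are R[i] (mathcomp
   real_closed `complex`) over an arbitrary R : realType. *)
From HB Require Import structures.
From mathcomp Require Import all_boot all_order all_algebra.
From mathcomp Require Import all_classical all_reals all_analysis.
From mathcomp Require Export complex.
Import Order.TTheory GRing.Theory Num.Theory numFieldNormedType.Exports.
Set Implicit Arguments.
Unset Strict Implicit.
Unset Printing Implicit Defensive.
Local Open Scope ring_scope.

(* conjugate transpose A^* *)
Definition adjmx (R : realType) (m n : nat) (A : 'M[R[i]]_(m, n)) : 'M[R[i]]_(n, m) :=
  (map_mx (fun x : R[i] => x^*) A)^T.

(* j = diag(I_{m1}, -I_{m2}) *)
Definition jmx (R : realType) (m1 m2 : nat) : 'M[R[i]]_(m1 + m2) :=
  block_mx 1%:M 0 0 (- 1%:M).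

(* A > 0 : Hermitian positive definite *)
Definition posdef (R : realType) (n : nat) (A : 'M[R[i]]_n) : Prop :=
  adjmx A = A /\ forall x : 'cV[R[i]]_n, x != 0 -> 0 < (adjmx x *m A *m x) 0 0.

(* A >= 0 : Hermitian positive semidefinite *)
Definition psd (R : realType) (n : nat) (A : 'M[R[i]]_n) : Prop :=
  adjmx A = A /\ forall x : 'cV[R[i]]_n, 0 <= (adjmx x *m A *m x) 0 0.

(* open lower half-plane C_- *)
Definition lower_half (R : realType) (z : R[i]) : Prop := complex.Im z < 0.

(* fundamental solution: W_0 = I_m, W_{k+1} = (I_m + i z j C_k) W_k *)
Fixpoint fundsol (R : realType) (m1 m2 : nat) (C : nat -> 'M[R[i]]_(m1 + m2))
    (z : R[i]) (k : nat) : 'M[R[i]]_(m1 + m2) :=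
  match k with
  | 0 => 1%:M
  | k'.+1 => (1%:M + ('i * z) *: (jmx R m1 m2 *m C k')) *m fundsol C z k'
  end.

(* q(z) = (1 + |z|^2)^{-1} *)
Definition qfun (R : realType) (z : R[i]) : R[i] := (1 + `|z| ^+ 2)^-1.

(* k-th term of the Weyl series *)
Definition weyl_term (R : realType) (m1 m2 : nat) (C : nat -> 'M[R[i]]_(m1 + m2))
    (phi : R[i] -> 'M[R[i]]_(m1, m2)) (z : R[i]) (k : nat) : 'M[R[i]]_m2 :=
  let v : 'M[R[i]]_(m1 + m2, m2) := col_mx (phi z) 1%:M in
  qfun z ^+ k *: (adjmx v *m adjmx (fundsol C z k) *m C k *m fundsol C z k *m v).

(* phi is a Weyl function: for every z in C_- the series converges
   (convergence of the partial sums in the finite-dimensional matrix space,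
   i.e. entrywise convergence). *)
Definition is_weyl (R : realType) (m1 m2 : nat) (C : nat -> 'M[R[i]]_(m1 + m2))
    (phi : R[i] -> 'M[R[i]]_(m1, m2)) : Prop :=
  forall z : R[i], lower_half z ->
    forall (a b : 'I_m2),
      cvgn (fun n : nat => ((\sum_(k < n) weyl_term C phi z k) a b : R[i]^o)).

(* analytic (holomorphic) on C_-: every entry is complex differentiable at
   every point of the open set C_- *)
Definition analytic_lower (R : realType) (p r : nat) (f : R[i] -> 'M[R[i]]_(p, r)) : Prop :=
  forall (a : 'I_p) (b : 'I_r) (z : R[i]), lower_half z ->
    derivable (fun w : R[i]^o => (f w a b : R[i]^o)) z 1.

(* Main.v *)
Require Import Defs.
From HB Require Import structures.
From mathcomp Require Import all_boot all_order all_algebra.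
From mathcomp Require Import all_classical all_reals all_analysis.
From mathcomp Require Import complex.
From mathcomp Require Import ring lra.
Import Order.TTheory GRing.Theory Num.Theory numFieldNormedType.Exports.

(* With [q = 1 / (1 + |z|^2)] and [W_k] the fundamental solution, [C_k j C_k = j]
   gives [q^{k+1} W_{k+1}^* j W_{k+1}
          = q^k W_k^* j W_k - 2 (Im z) q^{k+1} W_k^* C_k W_k].
   On the lower half-plane the forms [q^k W_k^* j W_k] therefore increase from
   [j], and they are affine functions of the partial sums [S_k] of the Weyl
   series.  As [C_k >= j], also [S_k >= k j], so that [S_k] is unbounded on the
   vectors [(x, 0)], [x <> 0]; this gives uniqueness.  For existence, the upper
   left block of [W_n] is invertible, and [phi_n], defined by
   [W_n (phi_n, 1) = (0, y)] for some [y], makes the [n]-th form nonpositive,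
   hence all previous ones.  Thus [S_k <= c(z)] on [(phi_n, 1)] for [n >= k], and
   [S_k >= k j] applied to [phi_n - phi_m] yields
   [|phi_n - phi_m|^2 <= 4 c(z) / k] for [n, m >= k].  The limit inherits the
   nonpositivity of all the forms: the first one is contractivity, and all of
   them together bound the Weyl series.

   Each [phi_n] is rational without poles in the lower half-plane, so the
   locally uniform limit is, around every point, a uniform limit of
   polynomials.  Analyticity then follows from a Cauchy estimate for
   polynomials. *)

Set Implicit Arguments.
Unset Strict Implicit.
Unset Printing Implicit Defensive.
Local Open Scope classical_set_scope.
Local Open Scope ring_scope.

(** * Cauchy estimates for polynomials *)

Section CauchyEstimates.
Variable F : numClosedFieldType.
Implicit Types (p : {poly F}) (r M z h : F).

(* Averaging over [z] and [- z] turns [p] into its even part, a polynomial in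
   [z ^ 2] of half the degree with the same constant term. *)
Lemma poly_center_le p r M : 0 <= r ->
  (forall z, `|z| = r -> `|p.[z]| <= M) -> `|p.[0]| <= M.
Proof.
have [n] := ubnP (size p); elim: n p r => // n IHn p r pn r0 hp.
have [p1|p2] := leqP (size p) 1.
  by have := hp r (ger0_norm r0); rewrite (size1_polyC p1) !hornerC.
have Esq z : p.[z] + p.[- z] = 2 * (even_poly p).[z ^+ 2].
  rewrite -[in LHS](poly_even_odd p).
  rewrite !(hornerD, hornerM, hornerX, horner_comp, hornerXn) mulrNN -expr2.
  ring.
have -> : p.[0] = (even_poly p).[0].
  apply: (@mulfI _ 2); first by rewrite pnatr_eq0.
  have := Esq 0.
  by rewrite oppr0 expr2 mulr0 => <-; rewrite mulr_natl mulr2n.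
apply: (IHn _ (r ^+ 2)); last 2 first.
- by rewrite exprn_ge0.
- move=> w wr; have zr : `|sqrtC w| = r.
    by apply/eqP; rewrite -(@eqrXn2 _ 2) // -normrX sqrtCK wr.
  have : `|2 * (even_poly p).[w]| <= 2 * M.
    rewrite -[w in X in X <= _]sqrtCK -Esq (le_trans (ler_normD _ _)) //.
    by rewrite mulr_natl mulr2n lerD // hp // normrN.
  by rewrite normrM normr_nat ler_pM2l.
- rewrite ltnS in pn; apply: leq_trans pn; apply: leq_ltn_trans (size_even_poly p) _.
  by rewrite ltn_uphalf_double -addnn -[X in (X < _)%N]addn1 ltn_add2l.
Qed.


(** A substitute for the maximum principle, whose factor 2 reproduces itself in the induction. For
    [p = q X + c] the centre estimate gives [|c| <= M], hence [|q| <= 2 M / r] on the circle, and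
    then [|q(h) h| <= (4 M / r) (r / 4) = M]. *)
Lemma poly_disc_le p r M h : 0 < r ->
  (forall z, `|z| = r -> `|p.[z]| <= M) -> `|h| <= r / 4 -> `|p.[h]| <= 2 * M.
Proof.
move=> r0; have r_neq0 : r != 0 by rewrite gt_eqF.
elim/poly_ind: p M => [|q c IHq] M hp hr.
  have M0 : 0 <= M by apply: le_trans (hp r (gtr0_norm r0)).
  by rewrite horner0 normr0 mulr_ge0.
have cM : `|c| <= M.
  by have := poly_center_le (ltW r0) hp; rewrite !hornerE.
have hq z : `|z| = r -> `|q.[z]| <= 2 * M / r.
  move=> zr; rewrite ler_pdivlMr // -zr -normrM.
  have -> : q.[z] * z = (q * 'X + c%:P).[z] - c by rewrite !hornerE addrK.
  by rewrite (le_trans (ler_normB _ _)) // mulr_natl mulr2n lerD // hp.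
rewrite !hornerE (le_trans (ler_normD _ _)) // mulr_natl mulr2n lerD //.
rewrite normrM (le_trans (ler_pM _ _ (IHq _ hq hr) hr)) //.
by rewrite le_eqVlt; apply/orP; left; apply/eqP; field.
Qed.

Definition slope (f : F -> F) h : F := (f h - f 0) / h.

(** For [p = (q X + b) X + a] the slope at [h] is [q(h) h + b], so [b] cancels in the difference. On
    the circle [|q| <= 4 M / r^2], and [poly_disc_le] doubles this inside. Only [M] and [r] enter
    the constant, so the estimate survives uniform limits. *)
Lemma poly_slope_le p r M h h' : 0 < r ->
  (forall z, `|z| = r -> `|p.[z]| <= M) ->
  h != 0 -> h' != 0 -> `|h| <= r / 4 -> `|h'| <= r / 4 ->
  `|slope (horner p) h - slope (horner p) h'| <= 8 * M / r ^+ 2 * (`|h| + `|h'|).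
Proof.
move=> r0 + h0 h'0 hr h'r; have r_neq0 : r != 0 by rewrite gt_eqF.
elim/poly_ind: p => [|p1 a _] hp.
  have M0 : 0 <= M by apply: le_trans (hp r (gtr0_norm r0)).
  rewrite /slope !horner0 subrr !mul0r subrr normr0.
  by rewrite mulr_ge0 ?addr_ge0 // divr_ge0 ?mulr_ge0 // ltW.
have aM : `|a| <= M by have := poly_center_le (ltW r0) hp; rewrite !hornerE.
have hp1 z : `|z| = r -> `|p1.[z]| <= 2 * M / r.
  move=> zr; rewrite ler_pdivlMr // -zr -normrM.
  have -> : p1.[z] * z = (p1 * 'X + a%:P).[z] - a by rewrite !hornerE addrK.
  by rewrite (le_trans (ler_normB _ _)) // mulr_natl mulr2n lerD // hp.
have slopeE x : x != 0 -> slope (horner (p1 * 'X + a%:P)) x = p1.[x].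
  by move=> x0; rewrite /slope !hornerE ?mulr0 ?add0r addrK mulfK.
rewrite !slopeE //; move: hp1; elim/poly_ind: p1 {hp aM a slopeE} => [|q b _] hp1.
  have := le_trans (normr_ge0 _) (hp1 r (gtr0_norm r0)).
  rewrite ler_pdivlMr // mul0r pmulr_rge0 // => M0.
  rewrite !horner0 subrr normr0.
  by rewrite mulr_ge0 ?addr_ge0 // divr_ge0 ?mulr_ge0 // ltW.
have bM : `|b| <= 2 * M / r.
  by have := poly_center_le (ltW r0) hp1; rewrite !hornerE.
have hq z : `|z| = r -> `|q.[z]| <= 4 * M / r ^+ 2.
  move=> zr; have -> : 4 * M / r ^+ 2 = (2 * M / r + 2 * M / r) / r by field.
  rewrite ler_pdivlMr // -zr -normrM zr.
  have -> : q.[z] * z = (q * 'X + b%:P).[z] - b by rewrite !hornerE addrK.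
  by rewrite (le_trans (ler_normB _ _)) // lerD // hp1.
have hqx x : `|x| <= r / 4 -> `|q.[x] * x| <= 8 * M / r ^+ 2 * `|x|.
  move=> xr; rewrite normrM ler_wpM2r // (le_trans (poly_disc_le r0 hq xr)) //.
  by rewrite le_eqVlt; apply/orP; left; apply/eqP; field.
rewrite !hornerE opprD addrACA subrr addr0 mulrDr.
by rewrite (le_trans (ler_normB _ _)) // lerD // hqx.
Qed.

End CauchyEstimates.

(** * Uniform approximation by polynomials on a disc *)

Section PolynomialApproximation.
Variable F : numClosedFieldType.
Implicit Types (p : {poly F}) (r M z h : F) (f g : F -> F).

(** Stands in for holomorphy near [0]: it is stable under products and uniform limits, and it yields
    a derivative at the centre. *)
Definition polyapprox r f :=
  forall e, 0 < e -> exists p, forall h, `|h| <= r -> `|f h - p.[h]| <= e.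

Lemma poly_bounded r p : 0 <= r ->
  exists2 M, 0 <= M & forall h, `|h| <= r -> `|p.[h]| <= M.
Proof.
move=> r0; elim/poly_ind: p => [|p c [M M0 hM]].
  by exists 0 => // h _; rewrite horner0 normr0.
exists (M * r + `|c|) => [|h hr]; first by rewrite addr_ge0 ?mulr_ge0.
rewrite !hornerE (le_trans (ler_normD _ _)) // lerD2r normrM.
by rewrite ler_pM // hM.
Qed.

Lemma polyapprox_bounded r f : 0 <= r -> polyapprox r f ->
  exists2 M, 0 <= M & forall h, `|h| <= r -> `|f h| <= M.
Proof.
move=> r0 /(_ 1 ltr01)[p hp]; have [M M0 hM] := poly_bounded p r0.
exists (1 + M) => [|h hr]; first by rewrite addr_ge0.
rewrite -[f h](subrK p.[h]) (le_trans (ler_normD _ _)) // lerD ?hp ?hM //.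
Qed.

Lemma polyapprox_slope_le r f : 0 < r -> polyapprox r f -> exists K, 0 <= K /\
  forall h h', h != 0 -> h' != 0 -> `|h| <= r / 4 -> `|h'| <= r / 4 ->
    `|slope f h - slope f h'| <= K * (`|h| + `|h'|).
Proof.
move=> r0 fr; have [M M0 hM] := polyapprox_bounded (ltW r0) fr.
have K0 : 0 <= 8 * (M + r ^+ 2) / r ^+ 2.
  by rewrite divr_ge0 ?mulr_ge0 ?addr_ge0 // ?mulr_ge0 // ltW.
(* An approximant with error at most [r^2] is bounded by [M + r^2] on the circle, whatever [h] and
   [h'] are; the [1] pays for the approximation error of the two slopes. *)
exists (8 * (M + r ^+ 2) / r ^+ 2 + 1); split; first by rewrite addr_ge0.
move=> h h' h0 h'0 hr h'r.
have le_r x : `|x| <= r / 4 -> `|x| <= r.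
  by move=> /le_trans; apply; rewrite ler_pdivrMr // ler_peMr ?ler1n // ltW.
have hpos : 0 < `|h| by rewrite normr_gt0.
have h'pos : 0 < `|h'| by rewrite normr_gt0.
(* With this accuracy the errors [2 e / |h|] and [2 e / |h'|] of the two slopes
   add up to [|h| + |h'|]. *)
have /fr[p hp] : 0 < `|h| * `|h'| / 2 by rewrite divr_gt0 ?mulr_gt0.
set e := _ / 2 in hp.
have er : e <= r ^+ 2.
  rewrite /e ler_pdivrMr // (@le_trans _ _ (r ^+ 2)) //.
    by rewrite expr2 ler_pM ?le_r.
  by rewrite ler_peMr ?ler1n // exprn_ge0 // ltW.
have pM z : `|z| = r -> `|p.[z]| <= M + r ^+ 2.
  move=> zr; rewrite -[p.[z]](subrK (f z)) addrC (le_trans (ler_normD _ _)) //.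
  by rewrite lerD ?hM ?zr // distrC (le_trans (hp _ _)) ?zr.
have sfp x : x != 0 -> `|x| <= r / 4 -> `|slope f x - slope (horner p) x| <= 2 * e / `|x|.
  move=> x0 xr; rewrite /slope -mulrBl normrM normfV ler_wpM2r ?invr_ge0 //.
  have -> : f x - f 0 - (p.[x] - p.[0]) = (f x - p.[x]) - (f 0 - p.[0]) by ring.
  rewrite (le_trans (ler_normB _ _)) // mulr_natl mulr2n lerD // hp ?le_r //.
  by rewrite normr0 divr_ge0 // ltW.
have -> : slope f h - slope f h' = (slope (horner p) h - slope (horner p) h') +
   ((slope f h - slope (horner p) h) - (slope f h' - slope (horner p) h')) by ring.
rewrite (le_trans (ler_normD _ _)) // mulrDl lerD ?poly_slope_le // mul1r.
rewrite (le_trans (ler_normB _ _)) // (le_trans (lerD (sfp _ _ _) (sfp _ _ _))) //.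
rewrite le_eqVlt; apply/orP; left; apply/eqP; rewrite /e.
by field; rewrite !gt_eqF.
Qed.

Lemma polyapprox_poly r p : polyapprox r (horner p).
Proof. by move=> e e0; exists p => h _; rewrite subrr normr0 ltW. Qed.

Lemma polyapprox_ext r f g : (forall h, `|h| <= r -> f h = g h) ->
  polyapprox r f -> polyapprox r g.
Proof.
by move=> fg fr e /fr[p hp]; exists p => h hr; rewrite -fg // hp.
Qed.

Lemma polyapproxM r f g : 0 <= r -> polyapprox r f -> polyapprox r g ->
  polyapprox r (fun h => f h * g h).
Proof.
move=> r0 fr gr e e0; have [M M0 fM] := polyapprox_bounded r0 fr.
have M1 : 0 < M + 1 by rewrite ltr_wpDl.
have [|q hq] := gr (e / 2 / (M + 1)); first by rewrite !divr_gt0.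
have [N N0 qN] := poly_bounded q r0; have N1 : 0 < N + 1 by rewrite ltr_wpDl.
have [|p hp] := fr (e / 2 / (N + 1)); first by rewrite !divr_gt0.
exists (p * q) => h hr; rewrite hornerM.
have -> : f h * g h - p.[h] * q.[h] = f h * (g h - q.[h]) + (f h - p.[h]) * q.[h] by ring.
rewrite (le_trans (ler_normD _ _)) // [leRHS](splitr e) lerD // normrM.
  rewrite (@le_trans _ _ ((M + 1) * (e / 2 / (M + 1)))) //.
    by rewrite ler_pM ?hq // (le_trans (fM _ hr)) // lerDl.
  by rewrite mulrC divfK // gt_eqF.
rewrite (@le_trans _ _ ((e / 2 / (N + 1)) * (N + 1))) //.
  by rewrite ler_pM ?hp // (le_trans (qN _ hr)) // lerDl.
by rewrite divfK // gt_eqF.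
Qed.

Lemma polyapprox_lim r f :
  (forall e, 0 < e -> exists g, polyapprox r g /\
     forall h, `|h| <= r -> `|f h - g h| <= e) -> polyapprox r f.
Proof.
move=> fr e e0; have e2 : 0 < e / 2 by rewrite divr_gt0.
have [g [/(_ _ e2)[p hp] fg]] := fr _ e2.
exists p => h hr; rewrite -(subrKA (g h)) (le_trans (ler_normD _ _)) //.
by rewrite [leRHS](splitr e) lerD ?fg ?hp.
Qed.

End PolynomialApproximation.

(** * Geometric series, completeness and complex derivatives *)

Section ComplexAnalysis.
Variable R : realType.
Implicit Types (z h b : R[i]) (p q : {poly R[i]}).

Lemma gt0_realP z : 0 < z -> exists2 x : R, 0 < x & z = x%:C%C.
Proof. by case: z => x y; rewrite ltcE /= => /andP[/eqP -> x0]; exists x. Qed.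

Lemma ge0_realP z : 0 <= z -> exists2 x : R, 0 <= x & z = x%:C%C.
Proof. by case: z => x y; rewrite lecE /= => /andP[/eqP -> x0]; exists x. Qed.

Lemma ReB z h : complex.Re (z - h) = complex.Re z - complex.Re h.
Proof. by case: z h => [a b] []. Qed.

Lemma ImB z h : complex.Im (z - h) = complex.Im z - complex.Im h.
Proof. by case: z h => [a b] []. Qed.

Lemma half_expn_lt (e : R[i]) : 0 < e -> exists n, (2^-1) ^+ n <= e.
Proof.
move=> /gt0_realP[x x0 ->].
have := archi_boundP (ltW (divr_gt0 ltr01 x0)); set n := Num.bound _ => hn.
exists n; have -> : (2^-1 : R[i]) ^+ n = ((2^-1) ^+ n)%:C%C.
  by rewrite rmorphXn fmorphV rmorph_nat.
rewrite lecR exprVn invf_ple ?posrE ?exprn_gt0 //.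
rewrite -div1r (le_trans (ltW hn)) // -natrX ler_nat.
by rewrite ltnW // ltn_expl.
Qed.

(** Truncated geometric series: after [n] terms the remainder is [(h / b)^n / (h - b)], and on the
    disc [|h / b| <= 1/2] and [|h - b| >= r]. *)
Lemma polyapprox_inv_linear (r b : R[i]) : 0 < r -> 2 * r <= `|b| ->
  polyapprox r (fun h => (h - b)^-1).
Proof.
move=> r0 rb; have b0 : b != 0.
  by rewrite -normr_gt0 (lt_le_trans _ rb) // mulr_gt0.
have geo n : exists p, forall h, h != b -> (h - b)^-1 - p.[h] = (h / b) ^+ n / (h - b).
  elim: n => [|n [p hp]].
    by exists 0 => h _; rewrite horner0 subr0 mul1r.
  exists (p - b ^- n.+1 *: 'X^n) => h hb; rewrite !hornerE opprD opprK addrA hp //.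
  rewrite [(h / b) ^+ n.+1]exprSr !exprMn exprVn exprS.
  by field; rewrite b0 subr_eq0 hb expf_neq0.
move=> e e0; have [|n hn] := @half_expn_lt (e * r); first by rewrite mulr_gt0.
have [p hp] := geo n; exists p => h hr.
have rhb : r <= `|h - b|.
  rewrite distrC (le_trans _ (lerB_dist _ _)) // lerBrDr (le_trans _ rb) //.
  by rewrite mulr_natl mulr2n lerD2l.
have hb : h != b by rewrite -subr_eq0 -normr_gt0 (lt_le_trans r0).
rewrite hp // normrM normfV ler_pdivrMr ?(lt_le_trans r0) //.
rewrite (@le_trans _ _ (e * r)) ?ler_wpM2l ?(ltW e0) // (le_trans _ hn) //.
rewrite normrX lerXn2r ?nnegrE ?invr_ge0 // normrM normfV.
rewrite ler_pdivrMr ?normr_gt0 // (le_trans hr) //.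
by rewrite mulrC ler_pdivlMr // mulrC.
Qed.

Lemma polyapprox_inv_poly (r : R[i]) q : 0 < r -> q != 0 ->
  (forall b, root q b -> 2 * r <= `|b|) -> polyapprox r (fun h => (q.[h])^-1).
Proof.
move=> r0 q0 hq; have [s sq] := closed_field_poly_normal q.
have hs b : b \in s -> 2 * r <= `|b|.
  move=> bs; apply: hq; rewrite sq rootZ ?lead_coef_eq0 //.
  by rewrite root_prod_XsubC.
have : polyapprox r (fun h => (\prod_(z <- s) ('X - z%:P)).[h]^-1).
  elim: s hs {sq} => [|b s IHs] hs.
    apply: polyapprox_ext _ (@polyapprox_poly _ r 1) => h _.
    by rewrite big_nil hornerC invr1.
  apply: polyapprox_ext _
    (polyapproxM (ltW r0) (polyapprox_inv_linear r0 (hs b _)) (IHs _)).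
  - by move=> h _; rewrite big_cons hornerM invfM !hornerE.
  - by rewrite mem_head.
  - by move=> z zs; apply: hs; rewrite in_cons zs orbT.
move=> /(polyapproxM (ltW r0) (@polyapprox_poly _ r (lead_coef q)^-1%:P)).
by apply: polyapprox_ext => h _; rewrite [in RHS]sq hornerC hornerZ invfM.
Qed.

Lemma normc_le_ReIm z : `|z| <= (`|complex.Re z| + `|complex.Im z|)%:C%C.
Proof.
rewrite {1}[z]complexE (le_trans (ler_normD _ _)) // rmorphD normrM.
rewrite complexiE normCi mul1r.
by rewrite !normc_def /= !expr0n /= !addr0 !sqrtr_sqr.
Qed.

Lemma Re_le_normc z (e : R) : `|z| <= e%:C%C -> `|complex.Re z| <= e.
Proof. by move=> /(le_trans (normc_ge_Re z)); rewrite lecR. Qed.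

Lemma Im_le_normc z (e : R) : `|z| <= e%:C%C -> `|complex.Im z| <= e.
Proof.
move=> ze; rewrite -normrN -ReiNIm; apply: Re_le_normc.
by rewrite normrM complexiE normCi mulr1.
Qed.

Lemma cvg_complex (u : nat -> R[i]^o) (l : R[i]) :
  (complex.Re (u n) @[n --> \oo] --> complex.Re l) ->
  (complex.Im (u n) @[n --> \oo] --> complex.Im l) -> u @ \oo --> (l : R[i]^o).
Proof.
move=> ul ul'; apply/cvgrPdist_le => _ /gt0_realP[e e0 ->].
have e2 : 0 < e / 2 by rewrite divr_gt0.
move/cvgrPdist_le: ul => /(_ _ e2) ul; move/cvgrPdist_le: ul' => /(_ _ e2) ul'.
near=> n; rewrite (le_trans (normc_le_ReIm _)) // lecR [leRHS]splitr lerD //.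
  by rewrite ReB; near: n; exact: ul.
by rewrite ImB; near: n; exact: ul'.
Unshelve. all: by end_near. Qed.

Lemma cauchy_rate_cvg (u : nat -> R) (e : nat -> R) :
  e @ \oo --> 0 -> (forall k n, (k <= n)%N -> `|u k - u n| <= e k) -> cvgn u.
Proof.
move=> /cvgrPdist_lt e0 ue; apply: cauchy_cvg; apply: cauchy_exP => d d0.
have [N _ hN] := e0 _ d0; exists (u N); exists N => // n Nn.
rewrite /= -ball_normE /ball_ /= (le_lt_trans (ue _ _ Nn)) //.
by have := hN N (leqnn N); rewrite /= sub0r normrN => /(le_lt_trans (ler_norm _)).
Qed.

(** Completeness is applied to real and imaginary parts separately. The rate passes to the distance
    from the limit, which later makes the convergence locally uniform. *)
Lemma complex_cauchy_rate (u : nat -> R[i]) (e : nat -> R) :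
  e @ \oo --> 0 -> (forall k n, (k <= n)%N -> `|u k - u n| <= (e k)%:C%C) ->
  exists2 l : R[i], (u : nat -> R[i]^o) @ \oo --> (l : R[i]^o) &
     forall n, `|u n - l| <= (e n)%:C%C.
Proof.
move=> e0 ue.
have /cvg_ex[a ha] : cvgn (fun n => complex.Re (u n)).
  by apply: cauchy_rate_cvg e0 _ => k n /ue /Re_le_normc; rewrite ReB.
have /cvg_ex[b hb] : cvgn (fun n => complex.Im (u n)).
  by apply: cauchy_rate_cvg e0 _ => k n /ue /Im_le_normc; rewrite ImB.
have ul := @cvg_complex u (Complex a b) ha hb.
exists (Complex a b) => // n; apply/ler_addgt0Pr => d d0.
move/cvgrPdist_le: ul => /(_ _ d0)[N _ hN].
rewrite -(subrKA (u (maxn n N))) (le_trans (ler_normD _ _)) // lerD ?ue ?leq_maxl //.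
by rewrite distrC; apply: (hN (maxn n N)); rewrite /= leq_maxr.
Qed.

Lemma cvg_harmonic_scale (c : R) : (c / n.+1%:R) @[n --> \oo] --> (0 : R).
Proof.
by rewrite -[X in _ --> X](mulr0 c); apply: cvgM cvg_harmonic; exact: cvg_cst.
Qed.

Lemma cvg_sqrt_harmonic (c : R) : Num.sqrt (c / n.+1%:R) @[n --> \oo] --> (0 : R).
Proof.
rewrite -[X in _ --> X]sqrtr0.
exact: (cvg_comp _ _ (cvg_harmonic_scale c) (@sqrt_continuous R 0)).
Qed.

(** The slopes form a Cauchy family as [h] tends to [0]. The derivative is their limit along the
    sequence [t n], and [slope_lim] transfers this limit to arbitrary [h]. *)
Lemma polyapprox_derivable (f : R[i] -> R[i]) (z : R[i]) (r : R) : 0 < r ->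
  polyapprox r%:C%C (fun h => f (h + z)) ->
  derivable (f : R[i]^o -> R[i]^o) z 1.
Proof.
move=> r0 fr; have rC0 : 0 < r%:C%C :> R[i] by rewrite ltcR.
have [_ [/ge0_realP[k k0 ->] hK]] := polyapprox_slope_le rC0 fr.
set g := fun h => f (h + z) in hK.
pose t n : R := r / 4 / n.+1%:R.
have t0 n : 0 < t n by rewrite !divr_gt0.
have tC0 n : (t n)%:C%C != 0 :> R[i] by rewrite gt_eqF // ltcR.
have normt n : `|(t n)%:C%C : R[i]| = (t n)%:C%C by rewrite ger0_norm // lecR ltW.
have r4 : (r%:C%C / 4 : R[i]) = (r / 4)%:C%C by rewrite rmorphM fmorphV rmorph_nat.
have tr n : `|(t n)%:C%C : R[i]| <= r%:C%C / 4.
  by rewrite normt r4 lecR ler_pdivrMr // ler_peMr ?ler1n // divr_ge0 // ltW.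
have [|i j ij|l _ ul] := @complex_cauchy_rate (fun n => slope g (t n)%:C%C)
    (fun n => 2 * k * (r / 4) / n.+1%:R).
- exact: cvg_harmonic_scale.
- rewrite (le_trans (hK _ _ _ _ _ _)) // !normt -rmorphD -rmorphM lecR.
  rewrite -[leRHS]mulrA -/(t i) [2 * k]mulrC -[leRHS]mulrA ler_wpM2l //.
  rewrite mulr_natl mulr2n lerD2l /t ler_wpM2l ?divr_ge0 ?(ltW r0) //.
  by rewrite lef_pV2 ?posrE // ler_nat.
have slope_lim h : h != 0 -> `|h| <= r%:C%C / 4 -> `|slope g h - l| <= k%:C%C * `|h|.
  move=> h0 hr; apply/ler_addgt0Pr => _ /gt0_realP[e e0 ->].
  (* The [3] is one [k * t N] from comparing the slopes at [h] and [t N], and two from the rate at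
     which the slope at [t N] approaches [l]. *)
  have [N _ hN] : \forall n \near \oo, 3 * k * (r / 4) / n.+1%:R < e.
    move/cvgrPdist_lt: (cvg_harmonic_scale (3 * k * (r / 4))) => /(_ _ e0)[N _ hN].
    exists N => // n /hN; rewrite sub0r normrN => /(le_lt_trans (ler_norm _)); exact.
  rewrite -(subrKA (slope g (t N)%:C%C)) (le_trans (ler_normD _ _)) //.
  rewrite (le_trans (lerD (hK _ _ h0 (tC0 N) hr (tr N)) (ul N))) //.
  rewrite mulrDr -addrA lerD2l normt -rmorphM -rmorphD lecR.
  apply: le_trans (ltW (hN N (leqnn N))); rewrite /t.
  by rewrite le_eqVlt; apply/orP; left; apply/eqP; ring.
apply/cvg_ex; exists l; apply/cvgrPdist_le => e e0.
have k1 : 0 < k%:C%C + 1 :> R[i] by rewrite ltr_wpDl // lecR.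
near=> h; have h0 : h != 0 by near: h; exact: nbhs_dnbhs_neq.
have hr : `|h| <= r%:C%C / 4 by near: h; apply: dnbhs0_le; rewrite divr_gt0.
have he : `|h| <= e / (k%:C%C + 1) by near: h; apply: dnbhs0_le; rewrite divr_gt0.
have -> : h^-1 *: (f (h *: (1 : R[i]^o) + z) - f z) = slope g h.
  by rewrite /slope /g add0r [RHS]mulrC -[h *: _]/(h * 1) mulr1.
rewrite distrC (le_trans (slope_lim _ h0 hr)) //.
rewrite (@le_trans _ _ ((k%:C%C + 1) * `|h|)) ?ler_wpM2r ?lerDl //.
by rewrite mulrC -ler_pdivlMr.
Unshelve. all: by end_near. Qed.

End ComplexAnalysis.

(** * Hermitian forms *)

Section ConjugateTranspose.
Variable R : realType.

Lemma Re_additive : {morph (@complex.Re R) : x y / x + y}.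
Proof. by case=> a b [c d]. Qed.

Lemma ReN x : complex.Re (- x : R[i]) = - complex.Re x.
Proof. by case: x. Qed.

Lemma Re_real_mul (a : R) (x : R[i]) : complex.Re (a%:C%C * x) = a * complex.Re x.
Proof. by case: x => b c /=; rewrite mul0r subr0. Qed.

Lemma Re_conj (x : R[i]) : complex.Re x^* = complex.Re x.
Proof. by case: x. Qed.

Lemma adjmxM m n p (A : 'M[R[i]]_(m, n)) (B : 'M[R[i]]_(n, p)) :
  adjmx (A *m B) = adjmx B *m adjmx A.
Proof. by rewrite /adjmx map_mxM trmx_mul. Qed.

Lemma adjmxD m n (A B : 'M[R[i]]_(m, n)) : adjmx (A + B) = adjmx A + adjmx B.
Proof. by rewrite /adjmx map_mxD linearD. Qed.

Lemma adjmxN m n (A : 'M[R[i]]_(m, n)) : adjmx (- A) = - adjmx A.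
Proof. by rewrite /adjmx map_mxN linearN. Qed.

Lemma adjmxZ m n a (A : 'M[R[i]]_(m, n)) : adjmx (a *: A) = a^* *: adjmx A.
Proof. by rewrite /adjmx map_mxZ linearZ. Qed.

Lemma adjmx1 n : adjmx (1%:M : 'M[R[i]]_n) = 1%:M.
Proof. by rewrite /adjmx map_mx1 trmx1. Qed.

Lemma adjmxK m n (A : 'M[R[i]]_(m, n)) : adjmx (adjmx A) = A.
Proof. by apply/matrixP=> i j; rewrite !mxE conjCK. Qed.

Lemma adj_jmx m1 m2 : adjmx (jmx R m1 m2) = jmx R m1 m2.
Proof.
rewrite /adjmx /jmx map_block_mx tr_block_mx.
by rewrite map_mxN !map_mx1 !map_mx0 linearN /= !trmx1 !trmx0.
Qed.

Lemma jmxK m1 m2 : jmx R m1 m2 *m jmx R m1 m2 = 1%:M.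
Proof.
rewrite /jmx mulmx_block !mul0mx !mulmx0 !addr0 add0r mulNmx mulmxN mulmx1 opprK.
by rewrite mul1mx -scalar_mx_block.
Qed.

(** Taking the real part puts all inequalities into the ordered field [R]. For Hermitian [A] nothing
    is lost on the diagonal, where the form is real, and [sform A] is symmetric. *)
Definition sform n (A : 'M[R[i]]_n) (y x : 'cV[R[i]]_n) : R :=
  complex.Re ((adjmx y *m A *m x) 0 0).

End ConjugateTranspose.

Local Notation qform A x := (sform A x x).

Section HermitianForms.
Variable R : realType.

Ltac sform_lra :=
  repeat match goal with |- context [sform ?A ?y ?x] =>
    let s := fresh "s" in move: (sform A y x) => s end;
  rewrite ?ler_norml; move=> *; try (apply/andP; split); lra.

Lemma sformDl n (A : 'M[R[i]]_n) y y' x :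
  sform A (y + y') x = sform A y x + sform A y' x.
Proof. by rewrite /sform adjmxD !mulmxDl mxE Re_additive. Qed.

Lemma sformDr n (A : 'M[R[i]]_n) y x x' :
  sform A y (x + x') = sform A y x + sform A y x'.
Proof. by rewrite /sform mulmxDr mxE Re_additive. Qed.

Lemma sformNl n (A : 'M[R[i]]_n) y x : sform A (- y) x = - sform A y x.
Proof. by rewrite /sform adjmxN !mulNmx mxE ReN. Qed.

Lemma sformNr n (A : 'M[R[i]]_n) y x : sform A y (- x) = - sform A y x.
Proof. by rewrite /sform mulmxN mxE ReN. Qed.

Lemma sformD n (A B : 'M[R[i]]_n) y x : sform (A + B) y x = sform A y x + sform B y x.
Proof. by rewrite /sform mulmxDr mulmxDl mxE Re_additive. Qed.

Lemma sformZ n (a : R) (A : 'M[R[i]]_n) y x : sform (a%:C%C *: A) y x = a * sform A y x.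
Proof. by rewrite /sform -scalemxAr -scalemxAl mxE Re_real_mul. Qed.

Lemma sform_congr m n (A : 'M[R[i]]_n) (V W : 'M[R[i]]_(n, m)) y x :
  sform (adjmx V *m A *m W) y x = sform A (V *m y) (W *m x).
Proof. by rewrite /sform adjmxM !mulmxA. Qed.

Lemma sform_sym n (A : 'M[R[i]]_n) y x : adjmx A = A -> sform A y x = sform A x y.
Proof.
move=> hA; rewrite /sform -[in RHS]Re_conj; congr complex.Re.
have -> : ((adjmx x *m A *m y) 0 0)^* = adjmx (adjmx x *m A *m y) 0 0.
  by rewrite !mxE.
by rewrite !adjmxM adjmxK hA mulmxA.
Qed.

Lemma posdef_qform_ge0 n (A : 'M[R[i]]_n) x : posdef A -> 0 <= qform A x.
Proof.
case=> _ hA; have [->|/hA] := eqVneq x 0; first by rewrite /sform mulmx0 mxE.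
by rewrite ltcE => /andP[_ /ltW].
Qed.

(** Positivity at [x + y] and [x - y] already bounds [2 |sform A y x|] by the right-hand side. This
    serves to control off-diagonal entries of the Weyl series by diagonal ones. *)
Lemma posdef_sform_le n (A : 'M[R[i]]_n) y x :
  posdef A -> `|sform A y x| <= qform A x + qform A y.
Proof.
move=> hA; have := posdef_qform_ge0 (x + y) hA; have := posdef_qform_ge0 (x - y) hA.
have := posdef_qform_ge0 x hA; have := posdef_qform_ge0 y hA.
rewrite !sformDl !sformDr !sformNl !sformNr (sform_sym x y hA.1).
sform_lra.
Qed.

Lemma posdef_qformB_le n (A : 'M[R[i]]_n) y x :
  posdef A -> qform A (x - y) <= 2 * (qform A x + qform A y).
Proof.
move=> hA; have := posdef_qform_ge0 (x + y) hA.
rewrite !sformDl !sformDr !sformNl !sformNr (sform_sym x y hA.1).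
sform_lra.
Qed.

(* [x^* C x + s x^* j x = (x + s j C x)^* C (x + s j C x) / 2] for [s = 1, -1]. *)
Lemma posdef_ge_j m1 m2 (C : 'M[R[i]]_(m1 + m2)) x :
  posdef C -> C *m jmx R m1 m2 *m C = jmx R m1 m2 ->
  `|qform (jmx R m1 m2) x| <= qform C x.
Proof.
set J := jmx R m1 m2 => hC CJC.
have h1 : sform C x (J *m C *m x) = qform J x.
  by rewrite /sform !mulmxA -2!(mulmxA (adjmx x)) CJC.
have h2 : qform C (J *m C *m x) = qform C x.
  rewrite -sform_congr adjmxM adj_jmx hC.1 -/J.
  have -> : C *m J *m C *m (J *m C) = C by rewrite CJC mulmxA jmxK mul1mx.
  by [].
have := posdef_qform_ge0 (x + J *m C *m x) hC.
have := posdef_qform_ge0 (x - J *m C *m x) hC.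
rewrite !sformDl !sformDr !sformNl !sformNr (sform_sym (J *m C *m x) x hC.1).
rewrite h1 h2 {h1 h2}.
sform_lra.
Qed.

Definition sqnorm n (x : 'cV[R[i]]_n) : R := qform 1%:M x.

Lemma sqnormE n (x : 'cV[R[i]]_n) :
  sqnorm x = \sum_i (complex.Re (x i 0) ^+ 2 + complex.Im (x i 0) ^+ 2).
Proof.
rewrite /sqnorm /sform mulmx1 !mxE (big_morph _ (@Re_additive R) (erefl _)).
apply: eq_bigr => i _; rewrite !mxE.
by case: (x i 0) => a b /=; ring.
Qed.

Lemma sqnorm_ge0 n (x : 'cV[R[i]]_n) : 0 <= sqnorm x.
Proof. by rewrite sqnormE sumr_ge0 // => i _; rewrite addr_ge0 ?sqr_ge0. Qed.

Lemma sqnorm_entry n (x : 'cV[R[i]]_n) i :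
  complex.Re (x i 0) ^+ 2 + complex.Im (x i 0) ^+ 2 <= sqnorm x.
Proof.
rewrite sqnormE (bigD1 i) //= lerDl sumr_ge0 // => k _.
by rewrite addr_ge0 ?sqr_ge0.
Qed.

Lemma sqnorm_eq0 n (x : 'cV[R[i]]_n) : sqnorm x <= 0 -> x = 0.
Proof.
move=> hx; apply/matrixP => i j; rewrite ord1 mxE.
have := le_trans (sqnorm_entry x i) hx; case: (x i 0) => a b /= h.
have sq0 (u v : R) : u ^+ 2 + v ^+ 2 <= 0 -> u = 0.
  move=> uv; apply/eqP; rewrite -sqrf_eq0; apply/eqP.
  by have := sqr_ge0 u; have := sqr_ge0 v; lra.
by rewrite (sq0 a b) // (sq0 b a) // addrC.
Qed.

Lemma qform_jmx m1 m2 (x : 'cV[R[i]]_m1) (y : 'cV[R[i]]_m2) :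
  qform (jmx R m1 m2) (col_mx x y) = sqnorm x - sqnorm y.
Proof.
rewrite /sqnorm /sform /jmx /adjmx map_col_mx tr_col_mx mul_row_block.
rewrite !mulmx0 addr0 add0r mulmxN mul_row_col mulNmx.
by rewrite !mulmx1 [_ 0 0]mxE Re_additive [X in _ + complex.Re X]mxE ReN.
Qed.

End HermitianForms.

(** * Energy identities for the Dirac system *)

Section DiracSystem.
Variables (R : realType) (m1 m2 : nat) (C : nat -> 'M[R[i]]_(m1 + m2)).
Hypothesis C_gt0 : forall k, posdef (C k).
Hypothesis CjC : forall k, C k *m jmx R m1 m2 *m C k = jmx R m1 m2.
Let J := jmx R m1 m2.
Let W z n := fundsol C z n.

Definition weight z : R := (1 + (complex.Re z ^+ 2 + complex.Im z ^+ 2))^-1.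

Lemma weight_gt0 z : 0 < weight z.
Proof. by rewrite invr_gt0 ltr_pwDl // addr_ge0 ?sqr_ge0. Qed.

Lemma qfunE (z : R[i]) : qfun z = (weight z)%:C%C.
Proof. by rewrite /qfun -add_Re2_Im2 /weight fmorphV [X in _ = X^-1]rmorphD rmorph1. Qed.

(** Expanding [(1 + i z j C)^* j (1 + i z j C)] with [j^2 = 1] and [C j C = j] gives
    [(1 + |z|^2) j + 2 Re(i z) C], and [Re(i z) = - Im z]. *)
Lemma dirac_step k z w :
  qform J ((1%:M + ('i * z) *: (J *m C k)) *m w) =
  (weight z)^-1 * qform J w - 2 * complex.Im z * qform (C k) w.
Proof.
rewrite -sform_congr adjmxD adjmxZ adjmx1 adjmxM adj_jmx (C_gt0 k).1 -/J.
have JJ : J *m J = 1%:M by exact: jmxK.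
have -> : (1%:M + ('i * z)^* *: (C k *m J)) *m J *m (1%:M + ('i * z) *: (J *m C k))
   = ((weight z)^-1)%:C%C *: J + (- (2 * complex.Im z))%:C%C *: C k.
  rewrite mulmxDl mul1mx -scalemxAl -mulmxA JJ mulmx1.
  rewrite mulmxDr mulmx1 mulmxDl -!scalemxAr mulmxA JJ mul1mx -scalemxAl.
  rewrite mulmxA CjC -/J.
  have -> : ((weight z)^-1)%:C%C = 1 + ('i * z) * ('i * z)^*.
    rewrite /weight invrK -complexiE; case: z => a b.
    by apply/eqP; rewrite eq_complex /=; apply/andP; split; apply/eqP; ring.
  have -> : (- (2 * complex.Im z))%:C%C = ('i * z) + ('i * z)^*.
    rewrite -complexiE; case: z => a b.
    by apply/eqP; rewrite eq_complex /=; apply/andP; split; apply/eqP; ring.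
  rewrite !scalerDl scale1r scalerA [X in _ + X = _]addrC addrACA.
  by rewrite [X in _ + X = _]addrC.
by rewrite sformD !sformZ mulNr.
Qed.

Definition jform z n x : R := weight z ^+ n * qform J (W z n *m x).

(** The form [S_n] of the Weyl series on all vectors, not only on the columns [(phi, 1)]: the
    estimates also need it on vectors [(x, 0)]. *)
Definition energy z n x : R :=
  \sum_(k < n) weight z ^+ k * qform (C k) (W z k *m x).

Lemma jform0 z x : jform z 0 x = qform J x.
Proof. by rewrite /jform /W /= expr0 !mul1mx mul1r. Qed.

Lemma jformS z n x : jform z n.+1 x =
  jform z n x - 2 * complex.Im z * weight z *
                (weight z ^+ n * qform (C n) (W z n *m x)).
Proof.
rewrite /jform /W /= -mulmxA dirac_step -/(W z n) exprSr.
have := weight_gt0 z; move: (weight z) (sform _ _ _) (sform _ _ _) => q s t q0.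
by field; rewrite gt_eqF.
Qed.

Lemma jform_energy z n x :
  jform z n x = qform J x - 2 * complex.Im z * weight z * energy z n x.
Proof.
elim: n => [|n IHn]; first by rewrite jform0 /energy big_ord0 mulr0 subr0.
by rewrite jformS IHn /energy big_ord_recr /=; ring.
Qed.

Lemma energy_term_ge0 z n x : 0 <= weight z ^+ n * qform (C n) (W z n *m x).
Proof. by rewrite mulr_ge0 ?posdef_qform_ge0 ?exprn_ge0 // ltW // weight_gt0. Qed.

Lemma energyB_le z n x y :
  energy z n (x - y) <= 2 * (energy z n x + energy z n y).
Proof.
rewrite /energy -big_split mulr_sumr; apply: ler_sum => k _ /=.
rewrite mulmxBr -mulrDr mulrCA ler_wpM2l ?posdef_qformB_le //.
by rewrite exprn_ge0 // ltW // weight_gt0.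
Qed.

Section LowerHalfPlane.
Variable z : R[i].
Hypothesis z_lower : lower_half z.

Lemma jform_le n k x : (n <= k)%N -> jform z n x <= jform z k x.
Proof.
move=> nk; rewrite -(subnKC nk); elim: (k - n)%N => [|i IHi]; first by rewrite addn0.
rewrite addnS (le_trans IHi) // jformS lerBrDl gerDr.
rewrite mulr_le0_ge0 ?energy_term_ge0 // mulr_le0_ge0 ?(ltW (weight_gt0 z)) //.
by rewrite mulr_ge0_le0 // ltW.
Qed.

(* [C >= j] bounds each energy term below by [jform], which increases from
   [x^* j x]. *)
Lemma energy_ge n x : n%:R * qform J x <= energy z n x.
Proof.
rewrite mulr_natl -[n in X in X <= _]card_ord -sumr_const; apply: ler_sum => k _.
rewrite -(jform0 z) (le_trans (jform_le x (leq0n k))) //.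
rewrite /jform ler_wpM2l ?exprn_ge0 ?(ltW (weight_gt0 z)) //.
exact: le_trans (ler_norm _) (posdef_ge_j _ (C_gt0 k) (CjC k)).
Qed.

(** Bound for the energy of [(phi x, x)] per unit of [|x|^2] once [jform] is nonpositive there; see
    [energy_weyl_le]. *)
Definition wradius : R := (- 2 * complex.Im z * weight z)^-1.

Lemma wradius_gt0 : 0 < wradius.
Proof.
rewrite /wradius invr_gt0 mulr_gt0 ?weight_gt0 //.
by move: z_lower; rewrite /lower_half => ?; lra.
Qed.

Lemma energyE n x : energy z n x = wradius * (jform z n x - qform J x).
Proof.
rewrite jform_energy /wradius; have := weight_gt0 z; move: z_lower.
rewrite /lower_half; move: (energy _ _ _) (weight z) (sform _ _ _) => e q s i0 q0.
by field; rewrite gt_eqF // lt_eqF.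
Qed.

(** If [x^* j x > 0], the linear growth in [energy_ge] passes any bound [b]. This is what excludes a
    second Weyl function. *)
Lemma bounded_energy_qform_le0 x b : (forall n, energy z n x <= b) -> qform J x <= 0.
Proof.
move=> hb; rewrite leNgt; apply/negP => x0.
have := archi_boundP (Num.Theory.normr_ge0 (b / qform J x)).
set N := Num.bound _ => hN.
have := le_trans (energy_ge N x) (hb N); apply/negP; rewrite -ltNge.
by rewrite -ltr_pdivrMr // (le_lt_trans (ler_norm _)).
Qed.

End LowerHalfPlane.
End DiracSystem.

(** * The Weyl function *)

Lemma unitmx_colP (F : fieldType) n (A : 'M[F]_n) :
  (forall x : 'cV_n, A *m x = 0 -> x = 0) -> A \in unitmx.
Proof.
(* [kermx] consists of row vectors killing a matrix from the left, so the column kernel of [A] is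
   reached by transposing. *)
move=> hA; rewrite -unitmx_tr -row_free_unit -kermx_eq0; apply/eqP.
apply: trmx_inj; rewrite trmx0; set B := _^T.
have AB : A *m B = 0 by rewrite -[A]trmxK -trmx_mul mulmx_ker trmx0.
apply/matrixP => i j.
have /matrixP/(_ i 0) : col j B = 0 by apply: hA; rewrite colE mulmxA AB mul0mx.
by rewrite !mxE.
Qed.

Section WeylApproximants.
Variables (R : realType) (m1 m2 : nat) (C : nat -> 'M[R[i]]_(m1 + m2)).
Hypothesis C_gt0 : forall k, posdef (C k).
Hypothesis CjC : forall k, C k *m jmx R m1 m2 *m C k = jmx R m1 m2.
Let J := jmx R m1 m2.
Let W z n := fundsol C z n.

Lemma sqnorm0 n : sqnorm (0 : 'cV[R[i]]_n) = 0.
Proof. by rewrite /sqnorm /sform mulmx0 mxE. Qed.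

(** Translating by [z] moves the point of interest to the origin, where the polynomial approximation
    is centred. *)
Lemma fundsol_poly z n : exists P : 'M[{poly R[i]}]_(m1 + m2),
  forall h, W (h + z) n = map_mx (horner_eval h) P.
Proof.
elim: n => [|n [P hP]]; first by exists 1%:M => h; rewrite map_mx1.
exists ((1%:M + ('i%:P * ('X + z%:P)) *: map_mx polyC (J *m C n)) *m P) => h.
rewrite map_mxM map_mxD map_mx1 map_mxZ -hP /W /=; congr ((_ + _ *: _) *m _).
  by rewrite /horner_eval !hornerE.
by apply/matrixP => i j; rewrite !mxE /horner_eval hornerC.
Qed.

Definition weyl_col (phi : 'M[R[i]]_(m1, m2)) : 'M[R[i]]_(m1 + m2, m2) := col_mx phi 1%:M.

Lemma weyl_colE phi (x : 'cV_m2) : weyl_col phi *m x = col_mx (phi *m x) x.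
Proof. by rewrite /weyl_col mul_col_mx mul1mx. Qed.

Lemma fundsol_col z n (x : 'cV_m1) (y : 'cV_m2) :
  W z n *m col_mx x y = col_mx (ulsubmx (W z n) *m x + ursubmx (W z n) *m y)
                               (dlsubmx (W z n) *m x + drsubmx (W z n) *m y).
Proof. by rewrite -[W z n in LHS]submxK mul_block_col. Qed.

Lemma jform_col0_le0 z n x y : W z n *m x = col_mx 0 y -> jform C z n x <= 0.
Proof.
move=> Wx; rewrite /jform -/(W z n) Wx qform_jmx sqnorm0.
rewrite sub0r mulrN oppr_le0.
by rewrite mulr_ge0 ?sqnorm_ge0 // exprn_ge0 // ltW // weight_gt0.
Qed.

(** For [x] in the kernel of the block, [W_n (x, 0) = (0, y)] makes the [n]-th form nonpositive,
    whereas its initial value, which is not larger, is [|x|^2]. *)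
Lemma fundsol_ul_unit z n : lower_half z -> ulsubmx (W z n) \in unitmx.
Proof.
move=> zl; apply: unitmx_colP => x Ax.
have : jform C z n (col_mx x 0) <= 0.
  apply: (@jform_col0_le0 _ _ _ (dlsubmx (W z n) *m x)).
  by rewrite fundsol_col Ax !mulmx0 !addr0.
move=> /(le_trans (jform_le C_gt0 CjC zl _ (leq0n n))).
rewrite jform0 qform_jmx sqnorm0 subr0.
exact: sqnorm_eq0.
Qed.

(** The solution [phi] of the equation saying that the upper block of [W_n (phi, 1)] vanishes. On a
    singular block [invmx] returns its argument, so the formula is used only where [fundsol_ul_unit]
    applies. *)
Definition weyl_approx n z : 'M[R[i]]_(m1, m2) :=
  - (invmx (ulsubmx (W z n)) *m ursubmx (W z n)).

Lemma jform_weyl_approx z n k x : lower_half z -> (k <= n)%N ->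
  jform C z k (weyl_col (weyl_approx n z) *m x) <= 0.
Proof.
move=> zl kn; apply: le_trans (jform_le C_gt0 CjC zl _ kn) _.
rewrite weyl_colE; apply: jform_col0_le0; rewrite fundsol_col /weyl_approx.
by rewrite mulNmx mulmxN -mulmxA mulKVmx ?fundsol_ul_unit // addNr.
Qed.

Lemma energy_weyl_le z k (phi : 'M[R[i]]_(m1, m2)) x : lower_half z ->
  jform C z k (weyl_col phi *m x) <= 0 ->
  energy C z k (weyl_col phi *m x) <= wradius z * sqnorm x.
Proof.
move=> zl hj; rewrite (energyE C_gt0 CjC zl) ler_wpM2l ?(ltW (wradius_gt0 zl)) //.
rewrite [X in _ - X](_ : _ = sqnorm (phi *m x) - sqnorm x); last first.
  by rewrite weyl_colE qform_jmx.
move: hj (sqnorm_ge0 (phi *m x)).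
by move: (jform _ _ _ _) (sqnorm _) (sqnorm _) => s t u; lra.
Qed.

Lemma weyl_colB (phi psi : 'M[R[i]]_(m1, m2)) (x : 'cV_m2) :
  weyl_col phi *m x - weyl_col psi *m x = col_mx ((phi - psi) *m x) 0.
Proof. by rewrite !weyl_colE opp_col_mx add_col_mx subrr mulmxBl. Qed.

(** The two columns differ by a vector [(d, 0)], on which the energy is at least [k |d|^2]. The [4]
    is the [2] of [energyB_le] times two approximants. *)
Lemma weyl_approx_dist z k n n' x : lower_half z -> (k <= n)%N -> (k <= n')%N ->
  k%:R * sqnorm ((weyl_approx n z - weyl_approx n' z) *m x)
    <= 4 * wradius z * sqnorm x.
Proof.
move=> zl kn kn'.
have := energy_ge C_gt0 CjC zl k (col_mx ((weyl_approx n z - weyl_approx n' z) *m x) 0).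
rewrite qform_jmx sqnorm0 subr0 -weyl_colB.
move=> /le_trans; apply; apply: le_trans (energyB_le C_gt0 z k _ _) _.
have En := energy_weyl_le zl (jform_weyl_approx x zl kn).
have En' := energy_weyl_le zl (jform_weyl_approx x zl kn').
apply: le_trans (ler_wpM2l _ (lerD En En')) _ => //.
move: (wradius z) (sqnorm x) => s t.
by have -> : 2 * (s * t + s * t) = 4 * s * t by ring.
Qed.

End WeylApproximants.

(** * Entrywise limits of matrix sequences *)

Section EntrywiseConvergence.
Variable R : realType.

Definition mcvg m n (u : nat -> 'M[R[i]]_(m, n)) (l : 'M[R[i]]_(m, n)) :=
  forall a b, (fun k => u k a b : R[i]^o) @ \oo --> (l a b : R[i]^o).

Lemma mcvg_cst m n (A : 'M[R[i]]_(m, n)) : mcvg (fun=> A) A.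
Proof. by move=> a b; exact: cvg_cst. Qed.

Lemma mcvgM m n p (u : nat -> 'M[R[i]]_(m, n)) (v : nat -> 'M[R[i]]_(n, p)) l l' :
  mcvg u l -> mcvg v l' -> mcvg (fun k => u k *m v k) (l *m l').
Proof.
move=> ul vl a b; rewrite mxE.
have -> : (fun k => (u k *m v k) a b : R[i]^o) =
          (fun k => \sum_j (u k a j * v k j b : R[i]^o)).
  by apply/funext => k; rewrite mxE.
apply: cvg_big => [|j _]; first exact: add_continuous.
exact: (cvgM (ul a j) (vl j b)).
Qed.

Lemma mcvg_adj m n (u : nat -> 'M[R[i]]_(m, n)) l :
  mcvg u l -> mcvg (fun k => adjmx (u k)) (adjmx l).
Proof.
move=> ul a b; apply/cvgrPdist_le => e e0.
move/cvgrPdist_le: (ul b a) => /(_ e e0); apply: filterS => k.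
by rewrite !mxE -rmorphB norm_conjC.
Qed.

Lemma mcvg_col m n p (u : nat -> 'M[R[i]]_(m, p)) (v : nat -> 'M[R[i]]_(n, p)) l l' :
  mcvg u l -> mcvg v l' -> mcvg (fun k => col_mx (u k) (v k)) (col_mx l l').
Proof.
move=> ul vl a b; rewrite mxE; case ea: (fintype.split a) => [j|j].
  by under eq_fun do rewrite mxE ea; exact: ul.
by under eq_fun do rewrite mxE ea; exact: vl.
Qed.

Lemma cvg_Re (u : nat -> R[i]^o) (l : R[i]) :
  u @ \oo --> (l : R[i]^o) -> complex.Re (u n) @[n --> \oo] --> complex.Re l.
Proof.
move=> ul; apply/cvgrPdist_le => e e0; have e0' : 0 < e%:C%C :> R[i] by rewrite ltcR.
move/cvgrPdist_le: ul => /(_ _ e0'); apply: filterS => k.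
by rewrite -ReB; apply: Re_le_normc.
Qed.

Lemma mcvg_qform n (A : 'M[R[i]]_n) (u : nat -> 'cV[R[i]]_n) l :
  mcvg u l -> qform A (u k) @[k --> \oo] --> qform A l.
Proof.
move=> ul; apply: cvg_Re.
have : mcvg (fun k => adjmx (u k) *m A *m u k) (adjmx l *m A *m l).
  by apply: mcvgM => //; apply: mcvgM; [exact: mcvg_adj|exact: mcvg_cst].
exact.
Qed.

Lemma entry_le_sqrt m n (A : 'M[R[i]]_(m, n)) a b s :
  sqnorm (A *m delta_mx b 0) <= s -> `|A a b| <= (Num.sqrt s)%:C%C.
Proof.
move=> As; rewrite normc_def lecR ler_wsqrtr // (le_trans _ As) //.
by apply: le_trans (sqnorm_entry _ a); rewrite -colE mxE.
Qed.

Lemma sqnorm_delta n (b : 'I_n) : sqnorm (delta_mx b 0 : 'cV[R[i]]_n) = 1.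
Proof.
rewrite sqnormE (bigD1 b) //= big1 => [|k kb]; rewrite mxE ?eqxx ?(negPf kb) /=.
  by rewrite expr1n expr0n !addr0.
by rewrite expr0n addr0.
Qed.

End EntrywiseConvergence.

(** * The limit of the approximants and its contractivity *)

Section WeylFunction.
Variables (R : realType) (m1 m2 : nat) (C : nat -> 'M[R[i]]_(m1 + m2)).
Hypothesis C_gt0 : forall k, posdef (C k).
Hypothesis CjC : forall k, C k *m jmx R m1 m2 *m C k = jmx R m1 m2.
Let J := jmx R m1 m2.
Let W z n := fundsol C z n.

(* Indices are shifted by one so that the rate has no junk value at [n = 0]. *)
Definition weyl_rate (z : R[i]) n : R := Num.sqrt (4 * wradius z / n.+1%:R).

Lemma weyl_rate_cvg z : weyl_rate z @ \oo --> 0.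
Proof. exact: cvg_sqrt_harmonic. Qed.

Lemma weyl_approx_cauchy z a b k n : lower_half z -> (k <= n)%N ->
  `|weyl_approx C k.+1 z a b - weyl_approx C n.+1 z a b| <= (weyl_rate z k)%:C%C.
Proof.
move=> zl kn.
have -> : weyl_approx C k.+1 z a b - weyl_approx C n.+1 z a b =
   (weyl_approx C k.+1 z - weyl_approx C n.+1 z) a b.
  by rewrite [RHS]mxE [X in _ = _ + X]mxE.
apply: entry_le_sqrt; rewrite ler_pdivlMr // mulrC.
have := weyl_approx_dist C_gt0 CjC (delta_mx b 0) zl (leqnn k.+1) (kn : (k.+1 <= n.+1)%N).
by rewrite sqnorm_delta mulr1.
Qed.

(** Convergence is established only on the lower half-plane; elsewhere [lim] may be a default
    value. *)
Definition weyl_fun z : 'M[R[i]]_(m1, m2) :=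
  \matrix_(a, b) (lim ((fun n => weyl_approx C n.+1 z a b : R[i]^o) @ \oo) : R[i]).

Lemma weyl_funP z a b : lower_half z ->
  (fun n => weyl_approx C n.+1 z a b : R[i]^o) @ \oo --> (weyl_fun z a b : R[i]^o) /\
  forall n, `|weyl_approx C n.+1 z a b - weyl_fun z a b| <= (weyl_rate z n)%:C%C.
Proof.
move=> zl.
have [k n|l ul hl] :=
  @complex_cauchy_rate R (fun n => weyl_approx C n.+1 z a b) _ (@weyl_rate_cvg z).
  exact: (@weyl_approx_cauchy z a b k n zl).
have -> : weyl_fun z a b = l by rewrite mxE; apply: cvg_lim ul; exact: norm_hausdorff.
by [].
Qed.

(** With [k] fixed, the form is continuous in the vector and nonpositive at every approximant of
    index at least [k], hence at the limit. *)
Lemma jform_weyl_fun z k x : lower_half z ->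
  jform C z k (weyl_col (weyl_fun z) *m x) <= 0.
Proof.
move=> zl; rewrite /jform.
have q0 : 0 < weight z ^+ k by rewrite exprn_gt0 // weight_gt0.
rewrite pmulr_rle0 //.
have h : qform J (W z k *m (weyl_col (weyl_approx C n.+1 z) *m x)) @[n --> \oo] -->
    qform J (W z k *m (weyl_col (weyl_fun z) *m x)).
  apply: mcvg_qform; apply: mcvgM; first exact: mcvg_cst.
  apply: mcvgM; last exact: mcvg_cst.
  apply: mcvg_col; last exact: mcvg_cst.
  by move=> a b; case: (weyl_funP a b zl).
rewrite -(cvg_lim _ h) //; apply: limr_le; first by apply/cvg_ex; eexists; exact: h.
exists k => // n kn; rewrite -(pmulr_rle0 _ q0).
by apply: jform_weyl_approx => //; apply: leqW.
Qed.

(** In the order of [R[i]], [0 <= t] includes that [t] is real; this comes from Hermitian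
    symmetry. *)
Lemma hermitian_ge0 n (A : 'M[R[i]]_n) (x : 'cV[R[i]]_n) :
  adjmx A = A -> 0 <= qform A x -> 0 <= (adjmx x *m A *m x) 0 0.
Proof.
move=> hA; rewrite /sform; set t := _ 0 0 => t0.
have tJ : t^* = t.
  have -> : t^* = adjmx (adjmx x *m A *m x) 0 0 by rewrite /t !mxE.
  by rewrite !adjmxM adjmxK hA mulmxA.
move: tJ t0; case: t => a b [bb] /= a0; rewrite lecE /= a0 andbT.
by apply/eqP; lra.
Qed.

Lemma weyl_fun_contractive z : lower_half z ->
  psd (1%:M - adjmx (weyl_fun z) *m weyl_fun z).
Proof.
move=> zl.
have hA : adjmx (1%:M - adjmx (weyl_fun z) *m weyl_fun z) =
          1%:M - adjmx (weyl_fun z) *m weyl_fun z.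
  by rewrite adjmxD adjmxN adjmx1 adjmxM adjmxK.
split=> // x; apply: hermitian_ge0 => //.
have := jform_weyl_fun 0 x zl; rewrite jform0 weyl_colE qform_jmx.
have -> : qform (1%:M - adjmx (weyl_fun z) *m weyl_fun z) x =
    sqnorm x - sqnorm (weyl_fun z *m x).
  rewrite sformD /sqnorm -sform_congr mulmx1.
  by rewrite [in LHS]/sform mulmxN mulNmx [X in _ + complex.Re X]mxE ReN.
by move: (sqnorm _) (sqnorm _) => s t; lra.
Qed.

End WeylFunction.

(** * Convergence of the Weyl series and uniqueness *)

Section WeylFunctionProperties.
Variables (R : realType) (m1 m2 : nat) (C : nat -> 'M[R[i]]_(m1 + m2)).
Hypothesis C_gt0 : forall k, posdef (C k).
Hypothesis CjC : forall k, C k *m jmx R m1 m2 *m C k = jmx R m1 m2.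
Let J := jmx R m1 m2.
Let W z n := fundsol C z n.

Lemma ReM_sform n (A : 'M[R[i]]_n) c (y x : 'cV_n) :
  complex.Re (c * (adjmx y *m A *m x) 0 0) = sform A y (c *: x).
Proof. by rewrite /sform -scalemxAr [in RHS]mxE. Qed.

Lemma Im_ReM (t : R[i]) : complex.Im t = complex.Re (- 'i * t).
Proof. by rewrite -complexiE; case: t => a b /=; ring. Qed.

Lemma adjmx_entry m n (A : 'M[R[i]]_n) (V U : 'M[R[i]]_(n, m)) a b :
  (adjmx V *m A *m U) a b =
  (adjmx (V *m delta_mx a 0 : 'cV_n) *m A *m (U *m delta_mx b 0 : 'cV_n)) 0 0.
Proof.
have -> : adjmx (V *m delta_mx a 0 : 'cV_n) = row a (adjmx V).
  by rewrite rowE adjmxM /adjmx map_delta_mx trmx_delta.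
rewrite -colE -!row_mul [LHS]mxE [RHS]mxE [RHS]mxE; apply: eq_bigr => k _.
by rewrite [col _ _ _ _]mxE.
Qed.

Definition pairing_term z k y x : R :=
  weight z ^+ k * sform (C k) (W z k *m y) (W z k *m x).

(** The free factor [c] handles both parts of an entry through one real form: [c = 1] gives the real
    part and [c = - i] the imaginary part. *)
Lemma weyl_term_entry phi z k a b (c : R[i]) :
  complex.Re (c * weyl_term C phi z k a b) =
  pairing_term z k (weyl_col (phi z) *m delta_mx a 0)
                   (weyl_col (phi z) *m (c *: delta_mx b 0)).
Proof.
rewrite /weyl_term mxE qfunE -rmorphXn mulrCA Re_real_mul /pairing_term; congr (_ * _).
rewrite -/(weyl_col (phi z)) -/(W z k).
have -> : adjmx (weyl_col (phi z)) *m adjmx (W z k) *m C k *m W z k *m weyl_col (phi z) =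
   adjmx (W z k *m weyl_col (phi z)) *m C k *m (W z k *m weyl_col (phi z)).
  by rewrite adjmxM !mulmxA.
by rewrite adjmx_entry ReM_sform -!mulmxA -!scalemxAr.
Qed.

Lemma weyl_sum_entry phi z n a b (c : R[i]) :
  complex.Re (c * (\sum_(k < n) weyl_term C phi z k) a b) =
  \sum_(k < n) pairing_term z k (weyl_col (phi z) *m delta_mx a 0)
                   (weyl_col (phi z) *m (c *: delta_mx b 0)).
Proof.
rewrite summxE mulr_sumr (big_morph _ (@Re_additive R) (erefl _)).
by apply: eq_bigr => k _; rewrite weyl_term_entry.
Qed.

(** Absolute convergence: [posdef_sform_le] bounds each term by the corresponding terms of the two
    energies. *)
Lemma pairing_cvg z y x B B' :
  (forall n, energy C z n y <= B) -> (forall n, energy C z n x <= B') ->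
  cvgn (fun n => \sum_(k < n) pairing_term z k y x).
Proof.
move=> hy hx.
have -> : (fun n => \sum_(k < n) pairing_term z k y x) =
    series (fun k => pairing_term z k y x).
  by apply/funext => n; rewrite /series /= big_mkord.
apply: normed_cvg; apply: nondecreasing_is_cvgn.
  apply/nondecreasing_seqP => n; rewrite /= /series /= big_nat_recr //= lerDl.
  exact: normr_ge0.
exists (B + B') => _ [n _ <-].
apply: le_trans (lerD (hy n) (hx n)).
rewrite /= [series _ _](big_mkord xpredT) /energy -big_split; apply: ler_sum => k _ /=.
have q0 : 0 <= weight z ^+ k by rewrite exprn_ge0 // ltW // weight_gt0.
rewrite /pairing_term normrM (ger0_norm q0) -mulrDr ler_wpM2l // addrC.
exact: posdef_sform_le.
Qed.

Lemma weyl_fun_energy z n x : lower_half z ->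
  energy C z n (weyl_col (weyl_fun C z) *m x) <= wradius z * sqnorm x.
Proof. by move=> zl; apply: energy_weyl_le => //; apply: jform_weyl_fun. Qed.

Lemma weyl_fun_is_weyl : is_weyl C (weyl_fun C).
Proof.
move=> z zl a b.
set v := weyl_col (weyl_fun C z).
have cv c : cvgn (fun n => \sum_(k < n) pairing_term z k (v *m delta_mx a 0)
      (v *m (c *: delta_mx b 0))).
  exact: pairing_cvg (fun n => weyl_fun_energy n _ zl) (fun n => weyl_fun_energy n _ zl).
have /cvg_ex[l hl] := cv 1; have /cvg_ex[l' hl'] := cv (- 'i).
apply/cvg_ex; exists (Complex l l' : R[i]^o); apply: cvg_complex => /=.
  by under eq_fun do rewrite -[X in complex.Re X]mul1r weyl_sum_entry.
by under eq_fun do rewrite Im_ReM weyl_sum_entry.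
Qed.

Lemma energy_le z n k x : (n <= k)%N -> energy C z n x <= energy C z k x.
Proof.
move=> nk; rewrite -(subnKC nk) /energy big_split_ord /= lerDl sumr_ge0 // => i _.
exact: energy_term_ge0.
Qed.

(** The diagonal entries of the partial sums have the energies as real parts. From some [N] on these
    stay below the limit plus [1], and monotonicity in [n] covers the earlier ones. *)
Lemma is_weyl_energy psi z b : is_weyl C psi -> lower_half z ->
  exists B, forall n, energy C z n (weyl_col (psi z) *m delta_mx b 0) <= B.
Proof.
move=> hpsi zl; have /cvg_ex[l /cvg_Re hl] := hpsi z zl b b.
move/cvgrPdist_le: hl => /(_ 1 ltr01)[N _ hN].
exists (complex.Re l + 1) => n.
rewrite (le_trans (energy_le z _ (leq_maxl n N))) //.
have := hN (maxn n N) (leq_maxr n N); rewrite distrC ler_norml => /andP[_].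
rewrite lerBlDl addrC -[X in complex.Re X <= _]mul1r weyl_sum_entry.
by rewrite scale1r.
Qed.

Lemma weyl_unique phi psi z : is_weyl C phi -> is_weyl C psi -> lower_half z ->
  psi z = phi z.
Proof.
move=> hphi hpsi zl; apply/eqP; rewrite -subr_eq0; apply/eqP/matrixP => a b.
have [B hB] := is_weyl_energy b hphi zl; have [B' hB'] := is_weyl_energy b hpsi zl.
have : qform J (col_mx ((psi z - phi z) *m delta_mx b 0) 0) <= 0.
  apply: (bounded_energy_qform_le0 C_gt0 CjC zl (b := 2 * (B' + B))) => n.
  rewrite -weyl_colB (le_trans (energyB_le C_gt0 z n _ _)) //.
  by rewrite ler_wpM2l // lerD.
rewrite qform_jmx sqnorm0 subr0 => /sqnorm_eq0/matrixP/(_ a 0).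
by rewrite -colE !mxE.
Qed.

End WeylFunctionProperties.

(** * Analyticity of the Weyl function *)

Section Analyticity.
Variables (R : realType) (m1 m2 : nat) (C : nat -> 'M[R[i]]_(m1 + m2)).
Hypothesis C_gt0 : forall k, posdef (C k).
Hypothesis CjC : forall k, C k *m jmx R m1 m2 *m C k = jmx R m1 m2.

Lemma lower_half_ball (z h : R[i]) : `|h| < (- complex.Im z)%:C%C -> lower_half (h + z).
Proof.
have [x _ hx] := ge0_realP (normr_ge0 h); rewrite hx ltcR => xz.
have := @Im_le_normc R h x; rewrite hx => /(_ (lexx _)).
rewrite ler_norml /lower_half => /andP[_].
case: h z {hx} xz => a b [c d] /=; lra.
Qed.

(** Cramer's rule: the numerator comes from the adjugate, and the denominator is the determinant of
    the upper left block, nonzero by [fundsol_ul_unit]. *)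
Lemma weyl_approx_rational z n a b : exists N D : {poly R[i]}, forall h,
  lower_half (h + z) ->
  D.[h] != 0 /\ weyl_approx C n (h + z) a b = D.[h]^-1 * N.[h].
Proof.
have [P hP] := fundsol_poly C z n.
exists ((- (\adj (ulsubmx P) *m ursubmx P)) a b), (\det (ulsubmx P)) => h hz.
have Eul : ulsubmx (fundsol C (h + z) n) = map_mx (horner_eval h) (ulsubmx P).
  by rewrite hP map_ulsubmx.
have Eur : ursubmx (fundsol C (h + z) n) = map_mx (horner_eval h) (ursubmx P).
  by rewrite hP map_ursubmx.
have Edet : \det (ulsubmx (fundsol C (h + z) n)) = (\det (ulsubmx P)).[h].
  by rewrite Eul det_map_mx.
have U := fundsol_ul_unit C_gt0 CjC n hz.
split; first by rewrite -Edet -unitfE -unitmxE.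
rewrite /weyl_approx /invmx U Edet Eul Eur -map_mx_adj -scalemxAl -map_mxM.
by rewrite -scalerN -map_mxN !mxE.
Qed.

(** On this disc [- Im (h + z)] stays at least half of [- Im z], while [1 + |h + z|^2] is bounded.
    The rate of convergence thus becomes uniform near [z]. *)
Lemma wradius_bound z : lower_half z -> exists B : R, forall h,
  `|h| <= (- complex.Im z / 2)%:C%C -> wradius (h + z) <= B.
Proof.
rewrite /lower_half => z0.
exists ((1 + ((`|complex.Re z| + - complex.Im z / 2) ^+ 2
           + (`|complex.Im z| + - complex.Im z / 2) ^+ 2)) / - complex.Im z) => h hr.
have := Re_le_normc hr; have := Im_le_normc hr.
rewrite /wradius /weight.
have -> : complex.Re (h + z) = complex.Re h + complex.Re z by rewrite Re_additive.
have -> : complex.Im (h + z) = complex.Im h + complex.Im z by case: (h) (z) => ? ? [].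
move: z0; clear hr; move: (complex.Re h) (complex.Im h) (complex.Re z) (complex.Im z).
move=> a b c d d0 hb ha.
have hb' := hb; rewrite ler_norml in hb'; case/andP: hb' => _ hb'.
have bd : - d <= - 2 * (b + d) by lra.
have bd0 : 0 < - 2 * (b + d) by apply: lt_le_trans bd; lra.
rewrite invfM invrK mulrC ler_pM ?invr_ge0 ?(ltW bd0) //.
- by rewrite addr_ge0 ?addr_ge0 ?sqr_ge0.
- have sq (u v : R) : `|u| <= - d / 2 -> (u + v) ^+ 2 <= (`|v| + - d / 2) ^+ 2.
    move=> hu; rewrite -[leLHS]real_normK ?num_real // lerXn2r ?nnegrE //.
      by rewrite addr_ge0 // (le_trans _ hu).
    by rewrite (le_trans (ler_normD _ _)) // addrC lerD.
  by rewrite lerD2l lerD ?sq.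
- by rewrite lef_pV2 ?posrE // oppr_gt0.
Qed.

Lemma weyl_fun_analytic : analytic_lower (weyl_fun C).
Proof.
(* Half the distance to the real axis: the open disc of radius [2 r] still lies in the half-plane,
   which keeps the poles at the distance that [polyapprox_inv_poly] asks for. *)
move=> a b z zl; set r := - complex.Im z / 2.
have r0 : 0 < r by rewrite divr_gt0 // oppr_gt0.
have rC0 : 0 < r%:C%C :> R[i] by rewrite ltcR.
have r2 : 2 * r%:C%C = (- complex.Im z)%:C%C :> R[i].
  by rewrite -[2](rmorph_nat (real_complex R)) -rmorphM /r mulrC divfK.
have lower h : `|h| <= r%:C%C -> lower_half (h + z).
  move=> hr; apply: lower_half_ball; rewrite (le_lt_trans hr) // -r2.
  by rewrite mulr_natl mulr2n ltrDl.
apply: (@polyapprox_derivable R (fun w => weyl_fun C w a b) z r r0).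
apply: polyapprox_lim => _ /gt0_realP[e e0 ->].
have [B hB] := wradius_bound zl.
have [n hn] : exists n, Num.sqrt (4 * B / n.+1%:R) <= e.
  have /cvgrPdist_le/(_ _ e0)[N _ hN] := cvg_sqrt_harmonic (4 * B); exists N.
  by have := hN N (leqnn N); rewrite /= sub0r normrN ger0_norm ?sqrtr_ge0.
exists (fun h => weyl_approx C n.+1 (h + z) a b); split; last first.
  move=> h hr; rewrite distrC.
  have [_ /(_ n)] := weyl_funP C_gt0 CjC a b (lower h hr).
  move=> /le_trans; apply; rewrite lecR (le_trans _ hn) // ler_wsqrtr //.
  by rewrite ler_wpM2r ?invr_ge0 // ler_wpM2l // hB.
have [N [D ND]] := weyl_approx_rational z n.+1 a b.
apply: (@polyapprox_ext _ _ (fun h => D.[h]^-1 * N.[h])).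
  by move=> h /lower /ND[].
apply: polyapproxM; first exact: ltW.
  apply: polyapprox_inv_poly => //.
    apply/eqP => D0; have [] := ND 0; first by rewrite add0r.
    by rewrite D0 horner0 eqxx.
  move=> c /rootP Dc; rewrite r2 real_leNgt ?normr_real //; last first.
    by apply/complex_realP; eexists.
  by apply/negP => /lower_half_ball /ND[]; rewrite Dc eqxx.
exact: polyapprox_poly.
Qed.

End Analyticity.

Theorem theorem2p2 (R : realType) (m1 m2 : nat)
    (C : nat -> 'M[R[i]]_(m1 + m2)) :
  (0 < m1)%N -> (0 < m2)%N ->
  (forall k, posdef (C k)) ->
  (forall k, C k *m jmx R m1 m2 *m C k = jmx R m1 m2) ->
  exists phi : R[i] -> 'M[R[i]]_(m1, m2),
    [/\ is_weyl C phi,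
        (forall psi : R[i] -> 'M[R[i]]_(m1, m2), is_weyl C psi ->
           forall z, lower_half z -> psi z = phi z),
        analytic_lower phi &
        (forall z, lower_half z -> psd (1%:M - adjmx (phi z) *m phi z))].
Proof.
move=> _ _ C_gt0 CjC; exists (weyl_fun C); split.
- exact: weyl_fun_is_weyl.
- move=> psi hpsi z; exact: (weyl_unique C_gt0 CjC (weyl_fun_is_weyl C_gt0 CjC) hpsi).
- exact: weyl_fun_analytic.
- by move=> z zl; apply: weyl_fun_contractive.
Qed.
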